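(* Let $X$ be reflexive and separable, and let $\bar x\in\mathcal F$ be a feasible point of the constraint system $x\in C$, $G(x)\in K$ which is sw-AKKT regular. Furthermore, assume that for all sequences $\{x^k\}\subset C$ and all $x\in C$ the following implication holds: $$x^k\rightharpoonup x\quad\text{and}\quad d_K(G(x^k))\to 0\quad\Longrightarrow\quad G(x)\in K .$$ Then Abadie's constraint qualification is valid at $\bar x$, i.e., $\mathcal T_{\mathcal F}(\bar x)=\mathcal L_{\mathcal F}(\bar x)$ holds and $\mathcal M(\bar x,0)$ is weak* closed.
   Context: Setting: $X$ and $Y$ are real Banach spaces, $G\colon X\to Y$ is continuously Fréchet differentiable, $C\subset X$ and $K\subset Y$ are nonempty, closed, convex sets, and $\mathcal F:=\{x\in C\mid G(x)\in K\}$. $d_K(y)=\inf_{z\in K}\|y-z\|_Y$; $\rightharpoonup$, $\rightharpoonup^*$ denote weak and weak* convergence. For a closed set $Q$ and $\bar x\in Q$, the (Bouligand) tangent cone $\mathcal T_Q(\bar x)$ is the set of all $d$ for which there exist $\{x^k\}\subset Q$ and $t^k>0$, $t^k\to0$, with $x^k\to\bar x$ and $(x^k-\bar x)/t^k\to d$. The linearization cone is $\mathcal L_{\mathcal F}(\bar x):=\{d\in\mathcal T_C(\bar x)\mid G'(\bar x)d\in\mathcal T_K(G(\bar x))\}$. $\mathcal N_C(x):=\{v\in X^*\mid\langle v,z-x\rangle_X\le0\ \forall z\in C\}$ for $x\in C$ and $\mathcal N_C(x):=\varnothing$ for $x\notin C$. For $x\in X$ and $r\ge0$ let $$\mathcal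 M(x,r):=\{G'(x)^*\lambda+\mu\in X^*\mid \lambda\in Y^*,\ \mu\in\mathcal N_C(x),\ \langle\lambda,y-G(x)\rangle_Y\le r\ \forall y\in K\}.$$ A point $\bar x\in\mathcal F$ is sw-AKKT regular if every $\bar v\in X^*$ for which there exist sequences $\{x^k\}\subset X$, $\{r^k\}\subset[0,+\infty)$, $\{v^k\}\subset X^*$ with $x^k\to\bar x$ (strongly), $r^k\to0$, $v^k\rightharpoonup^*\bar v$ and $v^k\in\mathcal M(x^k,r^k)$ for all $k$ belongs to $\mathcal M(\bar x,0)$. *)

(* Defs.v *)
From HB Require Import structures.
From mathcomp Require Import all_boot all_order all_algebra.
From mathcomp Require Import all_classical all_reals all_analysis.

Set Implicit Arguments.
Unset Strict Implicit.
Unset Printing Implicit Defensive.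

Import Order.TTheory GRing.Theory Num.Theory.
Import numFieldNormedType.Exports.

Local Open Scope classical_set_scope.
Local Open Scope ring_scope.

Section ContinuousLinear.
Context {R : realType} (X Y : normedModType R).

Definition clinear : {pred X -> Y} :=
  [pred f | `[< linear f /\ continuous f >]].

(* The bounded linear operators L(X, Y); carries the operator norm below. *)
Record clin := Clin { clin_val :> X -> Y; clin_valP : clin_val \in clinear }.

HB.instance Definition _ := [isSub for clin_val].
HB.instance Definition _ := [Choice of clin by <:].

Lemma clinearP f : reflect (linear f /\ continuous f) (f \in clinear).
Proof. exact: asboolP. Qed.

Lemma clin_linear (f : clin) : linear f.
Proof. by have /clinearP[] := clin_valP f. Qed.

Lemma clin_continuous (f : clin) : continuous f.
Proof. by have /clinearP[] := clin_valP f. Qed.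

HB.instance Definition _ (f : clin) :=
  GRing.isLinear.Build R X Y *:%R (clin_val f) (clin_linear f).

Lemma clinear_submod_closed : submod_closed clinear.
Proof.
split.
  apply/clinearP; split => [a u v|x]; first by rewrite /= scaler0 addr0.
  exact: cst_continuous.
move=> a f g /clinearP[lf cf] /clinearP[lg cg]; apply/clinearP; split.
  move=> b u v.
  rewrite ![(a *: f + g) _]/(a *: f _ + g _) lf lg.
  by rewrite !scalerDr addrACA !scalerA (mulrC a).
move=> x; apply: cvgD; last exact: cg.
by apply: cvgZl_tmp; exact: cf.
Qed.

HB.instance Definition _ :=
  GRing.isSubmodClosed.Build R (X -> Y) clinear clinear_submod_closed.
HB.instance Definition _ := [SubChoice_isSubLmodule of clin by <:].

Definition opnorm (f : clin) : R := sup [set `|f x| | x in [set x | `|x| <= 1]].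

Let opnorm_has_sup (f : clin) : has_sup [set `|f x| | x in [set x | `|x| <= 1]].
Proof.
split; first by exists `|f 0|, 0 => //=; rewrite normr0.
have /linear_bounded_continuous/bounded_funP/(_ 1)[M fM] := @clin_continuous f.
by exists M => _ [x /= x1 <-]; exact: fM.
Qed.

Lemma opnorm_ub (f : clin) x : `|x| <= 1 -> `|f x| <= opnorm f.
Proof. by move=> x1; apply: sup_upper_bound => //; exists x. Qed.

Lemma opnorm_le (f : clin) (M : R) :
  (forall x, `|x| <= 1 -> `|f x| <= M) -> opnorm f <= M.
Proof.
move=> fM; apply: ge_sup; first by have [] := opnorm_has_sup f.
by move=> _ [x /= x1 <-]; exact: fM.
Qed.

Lemma opnormD (f g : clin) : opnorm (f + g) <= opnorm f + opnorm g.
Proof.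
apply: opnorm_le => x x1; rewrite [(f + g) x]/(f x + g x).
by rewrite (le_trans (ler_normD _ _))// lerD// opnorm_ub.
Qed.

Lemma opnormZ (a : R) (f : clin) : opnorm (a *: f) = `|a| * opnorm f.
Proof.
have leZ (b : R) (g : clin) : opnorm (b *: g) <= `|b| * opnorm g.
  apply: opnorm_le => x x1; rewrite [(b *: g) x]/(b *: g x) normrZ.
  by rewrite ler_wpM2l// opnorm_ub.
apply/eqP; rewrite eq_le leZ/=; have [->|a0] := eqVneq a 0.
  rewrite normr0 mul0r (le_trans (normr_ge0 ((0 *: f) 0)))// opnorm_ub//.
  by rewrite normr0.
by rewrite -ler_pdivlMl ?normr_gt0// -normfV -[f in leLHS](scalerK a0).
Qed.

Lemma opnorm_eq0 (f : clin) : opnorm f = 0 -> f = 0.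
Proof.
move=> f0; apply/val_inj/funext => x; rewrite [RHS]/(0 : Y).
have [->|x0] := eqVneq x 0; first exact: (linear0 f).
have : `|f (`|x|^-1 *: x)| <= 0.
  rewrite -f0 opnorm_ub// normrZ normfV normr_id mulVf// normr_eq0//.
rewrite linearZ/= normrZ normfV normr_id pmulr_rle0 ?invr_gt0 ?normr_gt0//.
by rewrite normr_le0 => /eqP.
Qed.

HB.instance Definition _ :=
  Lmodule_isNormed.Build R clin opnormD opnormZ opnorm_eq0.

End ContinuousLinear.

(* The scalars are seen as a normed space over themselves. *)
Notation dual X := (clin X (GRing.regular _)).

Section Spaces.
Context {R : realType} (X : normedModType R).

Definition weak_topology :=
  initial_topology (fun (x : X) => (fun v : dual X => v x) : {ptws dual X -> R^o}).

Definition weak_star_topology :=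
  initial_topology (fun v : dual X => (v : {ptws X -> R^o})).

HB.instance Definition _ := Topological.on weak_topology.
HB.instance Definition _ := Topological.on weak_star_topology.

Definition weak_cvg (x_ : nat -> X) (x : X) :=
  (x_ : nat -> weak_topology) @ \oo --> (x : weak_topology).

Definition weak_star_cvg (v_ : nat -> dual X) (v : dual X) :=
  (v_ : nat -> weak_star_topology) @ \oo --> (v : weak_star_topology).

Definition weak_star_closed (M : set (dual X)) := closed (M : set weak_star_topology).

(* The canonical map of X into its bidual is onto. *)
Definition reflexive_space :=
  forall phi : dual (dual X), exists x : X, forall v : dual X, phi v = v x.

Definition separable_space := exists2 D : set X, countable D & dense D.

(* Relevant for nonempty A only: inf set0 = 0. *)
Definition distance (A : set X) (x : X) : R := inf [set `|x - z| | z in A].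

Definition tangent_cone (Q : set X) (xbar : X) : set X :=
  [set d | exists (x_ : nat -> X) (t : nat -> R),
    [/\ forall k, Q (x_ k), forall k, 0 < t k, t @ \oo --> (0 : R),
        x_ @ \oo --> xbar & (t k)^-1 *: (x_ k - xbar) @[k --> \oo] --> d]].

Definition normal_cone (C : set X) (x : X) : set (dual X) :=
  [set v : dual X | C x /\ forall z, C z -> v (z - x) <= 0].

End Spaces.

Section ConstraintSystem.
Context {R : realType} (X Y : normedModType R).

(* Continuity of DG is with respect to the operator norm. *)
Definition continuously_differentiable (G : X -> Y) :=
  exists2 DG : X -> clin X Y, (forall x, is_diff x G (DG x)) & continuous DG.

Context (G : X -> Y) (C : set X) (K : set Y).

Definition feasible : set X := [set x | C x /\ K (G x)].

Definition linearization_cone (xbar : X) : set X :=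
  [set d | tangent_cone C xbar d /\ tangent_cone K (G xbar) ('d G xbar d)].

(* The last clause says v = G'(x)^* lambda + mu, the adjoint being unfolded. *)
Definition Mset (x : X) (r : R) : set (dual X) :=
  [set v : dual X | exists (lambda : dual Y) (mu : dual X),
    [/\ normal_cone C x mu,
        forall y, K y -> lambda (y - G x) <= r &
        forall h, v h = lambda ('d G x h) + mu h]].

Definition sw_AKKT_regular (xbar : X) :=
  feasible xbar /\
  forall vbar : dual X,
    (exists (x_ : nat -> X) (r_ : nat -> R) (v_ : nat -> dual X),
      [/\ forall k, 0 <= r_ k, x_ @ \oo --> xbar, r_ @ \oo --> (0 : R),
          weak_star_cvg v_ vbar & forall k, Mset (x_ k) (r_ k) (v_ k)]) ->
    Mset xbar 0 vbar.

End ConstraintSystem.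

(* Main.v *)
(** A direction d of the linearization cone satisfies <v, d> <= 0 for every v
    in M(xbar, 0). If d were not tangent to the feasible set F, then for some
    e > 0 and all small t the point xbar + t d would be at distance at least
    e t from F. Minimize |x - xbar - s d| + n d_K(G x) - (e/2) s over x in C,
    0 <= s <= t. For n large the face s = t is not competitive: a sequence
    violating this is bounded, so it has a weak limit, which lies in F by the
    hypothesis on G, too close to xbar + t d. Ekeland's principle then gives
    an approximate minimizer with s < t, and convex duality for its
    first-order condition (Hahn-Banach for the convex value function of a
    perturbed problem) yields v in M(x, 0) with |v| <= 2 and <v, d> >= e/4,
    where x is close to xbar. Letting t tend to 0, a weak* limit of these v
    belongs to M(xbar, 0) by regularity, a contradiction.

    Regularity along the constant sequence xbar makes the convex set
    M(xbar, 0) norm closed, hence weak* closed since X is reflexive. *)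

Require Import Defs.
From HB Require Import structures.
From mathcomp Require Import all_boot all_order all_algebra.
From mathcomp Require Import all_classical all_reals all_analysis.
From mathcomp Require Import lra ring.

Set Implicit Arguments.
Unset Strict Implicit.
Unset Printing Implicit Defensive.

Import Order.TTheory GRing.Theory Num.Theory.
Import numFieldNormedType.Exports.

Local Open Scope classical_set_scope.
Local Open Scope ring_scope.

(** * Hahn-Banach theorem for convex functions *)

Definition convex_fun (R : realType) (V : lmodType R) (p : V -> R) :=
  forall x y a b, 0 <= a -> 0 <= b -> a + b = 1 ->
    p (a *: x + b *: y) <= a * p x + b * p y.

Section HahnBanach.
Context (R : realType) (V : lmodType R) (p : V -> R).
Hypothesis cvxp : convex_fun p.

(* Graphs of linear functionals defined on a subspace and dominated by p. *)
Let dominated (A : set (V * R)) :=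
  (forall z w a, A z -> A w -> A (a *: z.1 + w.1, a * z.2 + w.2)) /\
  (forall z, A z -> z.2 <= p z.1).

(** Two values over one point would put the whole line over 0 into [A], and [p 0] cannot bound that
    line from above. *)
Lemma dominated_fun_graph (A : set (V * R)) x r s :
  dominated A -> A (x, r) -> A (x, s) -> r = s.
Proof.
move=> [linA lepA] Axr Axs.
have A0 c : A (0, c * (r - s)).
  have := linA _ _ (-1) Axs Axr; rewrite /= scaleN1r addNr mulN1r addrC => A1.
  (* Closure is stated for [a z + w], so the multiple [c z] is reached as [(c - 1) z + z]. *)
  have := linA _ _ (c - 1) A1 A1; rewrite /= scaler0 addr0.
  by congr (A (_, _)); ring.
apply/eqP; apply: contraT; rewrite -subr_eq0 => rs0.
have := lepA _ (A0 ((p 0 + 1) / (r - s))) => /=.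
by rewrite mulfVK// gerDl ler10.
Qed.

(** The value [c] at [v] must lie above all slopes in the direction [- v] and below all slopes in
    the direction [v]. Convexity puts every lower slope below every upper one ([cross]), so the
    supremum of the lower slopes serves. *)
Lemma dominated_extend (A : set (V * R)) v :
  dominated A -> A (0, 0) ->
  exists c, dominated [set z | exists2 w, A w &
    exists a, z = (w.1 + a *: v, w.2 + a * c)].
Proof.
move=> [linA lepA] A0.
pose L := [set l | exists2 w, A w &
  exists2 b, 0 < b & l = (w.2 - p (w.1 - b *: v)) / b].
have cross z w a b : A z -> A w -> 0 < a -> 0 < b ->
    (w.2 - p (w.1 - b *: v)) / b <= (p (z.1 + a *: v) - z.2) / a.
  move=> Az Aw a0 b0; have ab0 : 0 < a + b by lra.
  (* With weights [b / (a + b)] and [a / (a + b)], the multiples of [v] in [z.1 + a *: v] and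
     [w.1 - b *: v] cancel, which leaves a point where [A] is already dominated. *)
  have /lepA/= := linA _ _ (b / (a + b)) Az
    (linA _ _ (a / (a + b) - 1) Aw Aw).
  set h := (X in p X); have -> : h = (b / (a + b)) *: (z.1 + a *: v) +
      (a / (a + b)) *: (w.1 - b *: v).
    rewrite /h -{2}[w.1]scale1r -scalerDl subrK scalerDr scalerBr addrACA.
    by rewrite !scalerA mulrAC (mulrAC a) (mulrC b a) addrN addr0.
  have ba1 : b / (a + b) + a / (a + b) = 1.
    by rewrite -mulrDl addrC divff// gt_eqF.
  have b_ge0 : 0 <= b / (a + b) by rewrite divr_ge0 ?ltW.
  have a_ge0 : 0 <= a / (a + b) by rewrite divr_ge0 ?ltW.
  move=> /le_trans/(_ (cvxp _ _ b_ge0 a_ge0 ba1)).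
  set P := p _; set Q := p _.
  have -> : b / (a + b) * z.2 + ((a / (a + b) - 1) * w.2 + w.2) =
     (b * z.2 + a * w.2) / (a + b) by field; rewrite gt_eqF.
  have -> : b / (a + b) * P + a / (a + b) * Q = (b * P + a * Q) / (a + b).
    by field; rewrite gt_eqF.
  rewrite ler_pM2r ?invr_gt0// => H.
  rewrite ler_pdivrMr// mulrAC ler_pdivlMr//.
  lra.
have L0 : L !=set0.
  by exists ((0 - p (0 - 1 *: v)) / 1); exists (0, 0) => //; exists 1.
have supL : has_sup L.
  split => //; exists ((p (0 + 1 *: v) - 0) / 1) => _ [w Aw [b b0 ->]].
  exact: (cross (0, 0) w).
exists (sup L); split.
  move=> _ _ a [z Az [b ->]] [w Aw [d ->]].
  exists (a *: z.1 + w.1, a * z.2 + w.2); first exact: linA.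
  exists (a * b + d) => /=; congr (_, _); last by ring.
  by rewrite scalerDr scalerA scalerDl addrACA.
move=> _ [z Az [a ->]] /=; have [a0|a0|->] := ltgtP a 0.
- have : (z.2 - p (z.1 - (- a) *: v)) / (- a) <= sup L.
    apply: sup_upper_bound => //; exists z => //.
    by exists (- a); rewrite ?oppr_gt0.
  rewrite scaleNr opprK ler_pdivrMr ?oppr_gt0//.
  lra.
- have : sup L <= (p (z.1 + a *: v) - z.2) / a.
    by apply: ge_sup => // _ [w Aw [b b0 ->]]; exact: cross.
  rewrite ler_pdivlMr//.
  lra.
- by rewrite scale0r mul0r !addr0; exact: lepA.
Qed.

(** A maximal dominated graph is total by one-dimensional extension, and single-valued, so it is the
    graph of the functional. *)
Theorem hahn_banach_convex : 0 <= p 0 ->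
  exists2 f : V -> R, linear (f : V -> R^o) & forall x, f x <= p x.
Proof.
move=> p0; have [A [domA maxA]] : exists A, dominated A /\
    forall B, A `<` B -> ~ dominated B.
  apply: Zorn_bigcup => F Fdom Ftot; split.
    move=> z w a [X FX Xz] [Y FY Yw].
    have [XY|YX] := Ftot _ _ FX FY.
      by exists Y => //; apply: (Fdom _ FY).1 => //; exact: XY.
    by exists X => //; apply: (Fdom _ FX).1 => //; exact: YX.
  by move=> z [X FX Xz]; exact: (Fdom _ FX).2.
have [linA lepA] := domA.
have A0 : A (0, 0).
  (* The empty graph is dominated as well, so it has to be excluded: [[set (0, 0)]] would strictly
     extend it, being dominated since [0 <= p 0]. *)
  have [[z Az]|/set0P/negP/negPn/eqP A0] := pselect (A !=set0).
    by have := linA _ _ (-1) Az Az; rewrite /= scaleN1r addNr mulN1r addNr.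
  have /maxA : A `<` [set (0, 0)] by rewrite A0; split => // /(_ (0, 0)); exact.
  by case; split => [_ _ a -> -> /=|_ -> //]; rewrite scaler0 addr0 mulr0 addr0.
have totA v : exists r, A (v, r).
  apply: contrapT => /forallNP nAv.
  have [c domB] := dominated_extend v domA A0.
  apply: maxA domB; split.
    move=> [x r] Axr; exists (x, r) => //; exists 0.
    by rewrite scale0r mul0r !addr0.
  move=> /(_ (v, c)) BA; apply: (nAv c); apply: BA; exists (0, 0) => //.
  by exists 1; rewrite scale1r mul1r !add0r.
have [f Af] := choice totA; exists f => [a x y|x]; last exact: lepA (Af x).
apply: (dominated_fun_graph domA) (Af _) _.
exact: linA _ _ a (Af x) (Af y).
Qed.

End HahnBanach.

(** * Bounded linear operators *)

Section BoundedOperators.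
Context (R : realType) (X Y : normedModType R).

Lemma clin_mk (f : X -> Y) (M : R) : linear f ->
  (forall x, `|f x| <= M * `|x|) -> exists F : clin X Y, F =1 f.
Proof.
move=> lf fM; have cf : continuous f.
  pose g : {linear X -> Y} := HB.pack f (GRing.isLinear.Build R X Y *:%R f lf).
  apply: (@bounded_linear_continuous _ _ _ g); apply/linear_boundedP.
  exists M; split; first exact: num_real.
  by move=> r Mr x; rewrite (le_trans (fM x))// ler_wpM2r// ltW.
have fin : f \in @clinear R X Y by apply/clinearP.
by exists (Clin fin).
Qed.

Lemma clin_normM (f : clin X Y) x : `|f x| <= `|f| * `|x|.
Proof.
have [->|x0] := eqVneq x 0; first by rewrite linear0 !normr0 mulr0.
have /(opnorm_ub f) : `| `|x|^-1 *: x| <= 1.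
  by rewrite normrZ normfV normr_id mulVf// normr_eq0.
by rewrite linearZ normrZ normfV normr_id ler_pdivrMl ?normr_gt0// mulrC.
Qed.

Lemma clin_norm_le (f : clin X Y) (M : R) : 0 <= M ->
  (forall x, `|f x| <= M * `|x|) -> `|f| <= M.
Proof.
move=> M0 fM; apply: opnorm_le => x x1.
by rewrite (le_trans (fM x))// ler_piMr.
Qed.

Lemma clinDE (f g : clin X Y) x : (f + g) x = f x + g x. Proof. by []. Qed.

Lemma clinNE (f : clin X Y) x : (- f) x = - f x. Proof. by []. Qed.

Lemma clinBE (f g : clin X Y) x : (f - g) x = f x - g x. Proof. by []. Qed.

Lemma clinZE a (f : clin X Y) x : (a *: f) x = a *: f x. Proof. by []. Qed.

End BoundedOperators.

(** Two explicit weights replace the single coefficient packed with its membership in the unit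
    interval. *)
Lemma convex_setP (R : realType) (X : lmodType R) (A : set X) :
  convex_set A <-> forall x y a b, A x -> A y -> 0 <= a -> 0 <= b -> a + b = 1 ->
    A (a *: x + b *: y).
Proof.
split=> [cA x y a b Ax Ay a0 b0 ab1|cA x y l].
  have a01 : Itv.spec (@Itv.num_sem R) (Itv.Real `[0%Z, 1%Z]) a.
    apply/andP; split; first exact: num_real.
    by rewrite /= in_itv/= a0/=; lra.
  have := cA x y (Itv.mk a01); rewrite !inE => /(_ Ax Ay).
  by have -> : b = 1 - a by lra.
rewrite !inE => Ax Ay; apply: cA => //.
by rewrite subr_ge0.
by rewrite addrC; exact: subrK.
Qed.

(** * The distance to a set *)

Section Distance.
Context (R : realType) (X : normedModType R) (A : set X).
Hypothesis A0 : A !=set0.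

Let has_inf_dist x : has_inf [set `|x - z| | z in A].
Proof.
split; first by have [a Aa] := A0; exists `|x - a|, a.
by exists 0 => _ [z Az <-].
Qed.

Lemma distance_ge0 x : 0 <= distance A x.
Proof. by apply: lb_le_inf => [|_ [z Az <-]//]; have [] := has_inf_dist x. Qed.

Lemma distance_le x z : A z -> distance A x <= `|x - z|.
Proof. by move=> Az; apply: inf_lbound; [have [] := has_inf_dist x|exists z]. Qed.

Lemma distance_in x : A x -> distance A x = 0.
Proof.
move=> Ax; apply/eqP; rewrite eq_le distance_ge0 andbT.
by rewrite (le_trans (distance_le x Ax))// subrr normr0.
Qed.

Lemma distance_approx x e : 0 < e -> exists2 z, A z & `|x - z| < distance A x + e.
Proof.
by move=> e0; have [_ [z Az <-] ?] := inf_adherent e0 (has_inf_dist x); exists z.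
Qed.

Lemma distance_lip x y : distance A x <= distance A y + `|x - y|.
Proof.
apply/ler_addgt0Pr => e e0; have [z Az yz] := distance_approx y e0.
rewrite (le_trans (distance_le x Az))// (le_trans (ler_distD y _ _))//.
by rewrite addrC addrAC lerD2r ltW.
Qed.

Lemma distance_convex : convex_set A -> convex_fun (distance A).
Proof.
move=> cA x y a b a0 b0 ab1; apply/ler_addgt0Pr => e e0.
have [z Az xz] := distance_approx x e0; have [w Aw yw] := distance_approx y e0.
have Azw : A (a *: z + b *: w) by apply: (iffLR (convex_setP _) cA).
rewrite (le_trans (distance_le _ Azw))// opprD addrACA -!scalerBr.
rewrite (le_trans (ler_normD _ _))// !normrZ !ger0_norm//.
have -> : e = a * e + b * e by rewrite -mulrDl ab1 mul1r.
rewrite addrACA -!mulrDr.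
by rewrite lerD// ler_wpM2l// ltW.
Qed.

Lemma distance_continuous : continuous (distance A : X -> R).
Proof.
move=> x; apply/cvgrPdist_le => /= e e0; near=> y.
have xy : `|x - y| <= e by near: y; apply: cvgr_dist_le.
rewrite ler_norml; apply/andP; split.
  by rewrite lerNl opprB lerBlDl (le_trans (distance_lip y x))// lerD2l distrC.
by rewrite lerBlDl (le_trans (distance_lip x y))// lerD2l.
Unshelve. all: by end_near. Qed.

Lemma distance_gt0 x : closed A -> ~ A x -> 0 < distance A x.
Proof.
move=> cA nAx; rewrite lt_def distance_ge0 andbT; apply/eqP => dx0; apply: nAx.
apply: cA => U /nbhs_ballP[e /= e0 xeU].
have [z Az xz] := distance_approx x e0.
by exists z; split => //; apply: xeU; rewrite -ball_normE/= -[ltRHS]add0r -dx0.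
Qed.

End Distance.

(** * Weak convergence and separation *)

(** Weak and weak* convergence are both instances: each topology is initial for a map into a space
    of functions with pointwise convergence. *)
Lemma initial_ptws_cvgP (S : choiceType) (U : topologicalType) (V : uniformType)
    (f : S -> {ptws U -> V}) (u : nat -> S) (s : S) :
  (u : nat -> initial_topology f) @ \oo --> (s : initial_topology f) <->
  forall x, f (u n) x @[n --> \oo] --> f s x.
Proof.
split=> [us x|us].
  have fc : continuous (f : initial_topology f -> {ptws U -> V}).
    exact: initial_continuous.
  have := cvg_comp _ _ us (fc s).
  by move=> /pointwise_cvgP; exact.
move=> A /= [_ [[B Bop <-] Bfs sBfA]].
have fu : f (u n) @[n --> \oo] --> f s.
  apply: (iffRL (@pointwise_cvgP U V (fmap (f \o u) \oo) (f s) _)) => x.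
  exact: us.
have {}fu : \forall n \near \oo, B (f (u n)).
  by apply: fu; rewrite nbhsE; exists B.
apply: (@filterS _ \oo _ _ _ _ fu) => n; exact: sBfA.
Qed.

(** A one-sided bound suffices, because by linearity it can be applied to [- x] too. *)
Lemma dual_mk (R : realType) (X : normedModType R) (f : X -> R) (M : R) :
  linear (f : X -> R^o) -> (forall x, f x <= M * `|x|) ->
  exists g : dual X, g =1 f.
Proof.
move=> lf fM; apply: (@clin_mk R X R^o f M lf) => x.
pose h : {linear X -> R^o} := HB.pack f (GRing.isLinear.Build R X R^o *:%R f lf).
rewrite ler_norml lerNl fM andbT.
by rewrite -[f]/(h : _ -> _) -linearN -normrN fM.
Qed.

Lemma hahn_banach_dual (R : realType) (X : normedModType R) (p : X -> R) (M : R) :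
  convex_fun p -> 0 <= p 0 -> (forall x, p x <= M * `|x|) ->
  exists g : dual X, forall x, g x <= p x.
Proof.
move=> cvxp p0 pM; have [f lf fp] := hahn_banach_convex cvxp p0.
have [x|g gf] := dual_mk lf (M := M); first exact: le_trans (fp x) (pM x).
by exists g => x; rewrite gf.
Qed.

Section WeakConvergence.
Context (R : realType) (X : normedModType R).

Lemma weak_cvgP (x_ : nat -> X) (x : X) :
  weak_cvg x_ x <-> forall v : dual X, v (x_ n) @[n --> \oo] --> (v x : R^o).
Proof. exact: initial_ptws_cvgP. Qed.

Lemma weak_star_cvgP (v_ : nat -> dual X) (v : dual X) :
  weak_star_cvg v_ v <-> forall x : X, v_ n x @[n --> \oo] --> (v x : R^o).
Proof. exact: initial_ptws_cvgP. Qed.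

Lemma weak_star_eval_continuous (x : X) :
  continuous (fun v : weak_star_topology X => (v : dual X) x : R^o).
Proof.
move=> v.
have fc : continuous (id : weak_star_topology X -> {ptws X -> R^o}).
  exact: initial_continuous.
have vv : (v' : {ptws X -> R^o}) @[v' --> v] --> (v : {ptws X -> R^o}).
  exact: fc.
exact: (iffLR (pointwise_cvgP _ _) vv x).
Qed.

(** The functional is a linear minorant of the increment [p] of the distance at [v], which is
    convex, vanishes at 0 and is at most the norm. At [m - v] with [m] in [A] the increment equals
    [- distance A v], so the gap is the distance itself. *)
Lemma strict_separation (A : set X) v : A !=set0 -> closed A -> convex_set A ->
  ~ A v -> exists (g : dual X) (e : R), 0 < e /\ forall m, A m -> g m <= g v - e.
Proof.
move=> A0 cA cvA nAv; pose p w := distance A (v + w) - distance A v.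
have cvxp : convex_fun p.
  move=> x y a b a0 b0 ab1; rewrite /p.
  have -> : v + (a *: x + b *: y) = a *: (v + x) + b *: (v + y).
    by rewrite !scalerDr addrACA -scalerDl ab1 scale1r.
  have := distance_convex A0 cvA (v + x) (v + y) a0 b0 ab1.
  have : distance A v = (a + b) * distance A v by rewrite ab1 mul1r.
  by lra.
have [||g gp] := hahn_banach_dual (M := 1) cvxp; first by rewrite /p addr0 subrr.
  move=> x; rewrite mul1r /p lerBlDl (le_trans (distance_lip A0 _ v))//.
  by rewrite (addrAC v) subrr add0r.
exists g, (distance A v); split; first exact: distance_gt0.
move=> m Am; rewrite -lerBlDl -linearB (le_trans (gp _))// /p.
by rewrite (addrC v) subrK distance_in// sub0r.
Qed.

(** A functional that strictly separates [x] from [A] keeps a fixed gap along the sequence, against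
    weak convergence. *)
Lemma closed_convex_weak_limit (A : set X) (x_ : nat -> X) x :
  closed A -> convex_set A -> (forall n, A (x_ n)) -> weak_cvg x_ x -> A x.
Proof.
move=> cA cvA Ax_ /weak_cvgP xx; apply: contrapT => nAx.
have A0 : A !=set0 by exists (x_ 0%N).
have [g [e [e0 ge]]] := strict_separation A0 cA cvA nAx.
have : g x <= g x - e.
  by apply: cvgr_to_le (xx g) _; apply: nearW => n; exact: ge.
by rewrite lerDl oppr_ge0 leNgt e0.
Qed.

(** Any linear minorant of [|y + x| - |x|] works: it is bounded by the norm, and at [y = - x] the
    minorized function is [- |x|]. *)
Lemma norming_functional (x : X) :
  exists2 g : dual X, `|g| <= 1 & `|x| <= `|g x|.
Proof.
pose p (y : X) := `|y + x| - `|x|.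
have cvxp : convex_fun p.
  move=> y z a b a0 b0 ab1; rewrite /p.
  have -> : a *: y + b *: z + x = a *: (y + x) + b *: (z + x).
    by rewrite !scalerDr addrACA -scalerDl ab1 scale1r.
  have := ler_normD (a *: (y + x)) (b *: (z + x)).
  rewrite !normrZ !ger0_norm//.
  have : `|x| = (a + b) * `|x| by rewrite ab1 mul1r.
  by lra.
have p_le y : p y <= 1 * `|y| by rewrite mul1r lerBlDr ler_normD.
have [||g gp] := hahn_banach_dual (M := 1) cvxp; rewrite ?/p ?add0r ?subrr//.
have g_le y : g y <= 1 * `|y| := le_trans (gp y) (p_le y).
exists g.
  apply: clin_norm_le => // y; rewrite ler_norml g_le andbT lerNl -normrN.
  by have := g_le (- y); rewrite linearN.
have := gp (- x); rewrite linearN /p addNr normr0 sub0r lerN2 => /le_trans; apply.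
exact: ler_norm.
Qed.

End WeakConvergence.

(** * Sequential compactness *)

Lemma increasing_seq_ge (f : nat -> nat) n : increasing_seq f -> (n <= f n)%N.
Proof.
move=> /increasing_seqP fincr; elim: n => // n ih.
exact: leq_ltn_trans ih (fincr n).
Qed.

(** Bolzano-Weierstrass refines [g j] to [g j.+1] so that [u j] converges along the latter; the
    diagonal [g n n] is eventually a subsequence of every stage. *)
Lemma diagonal_subsequence (R : realType) (u : nat -> nat -> R) (M : nat -> R) :
  (forall j n, `|u j n| <= M j) ->
  exists2 f : nat -> nat, increasing_seq f & forall j, cvgn (u j \o f).
Proof.
move=> uM.
have /choice[h hP] (jg : nat * (nat -> nat)) : exists h : nat -> nat,
    increasing_seq h /\ cvgn (u jg.1 \o jg.2 \o h).
  have [|h] := @bolzano_weierstrass R (u jg.1 \o jg.2); last by exists h.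
  exists (M jg.1); split; first exact: num_real.
  by move=> r Mr n _; rewrite /= (le_trans (uM _ _))// ltW.
pose g := fix g k : nat -> nat :=
  if k is j.+1 then g j \o h (j, g j) else id.
have gfactor j k : exists2 l, increasing_seq l & g (j + k)%N = g j \o l.
  elim: k => [|k [l lincr lE]]; first by exists id; rewrite ?addn0.
  exists (l \o h ((j + k)%N, g (j + k)%N)); last by rewrite addnS/= lE.
  by move=> m n; exact: etrans (lincr _ _) ((hP _).1 _ _).
have gincr k : increasing_seq (g k).
  by have [l lincr] := gfactor 0%N k; rewrite add0n => ->.
exists (fun n => g n n).
  apply/increasing_seqP => n /=; rewrite (leW_mono (gincr n)).
  exact: increasing_seq_ge (hP (n, g n)).1.
move=> j; have [l /cvgrPdist_lt lP] := iffLR (cvg_ex _) (hP (j, g j)).2.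
apply/cvg_ex; exists l; apply/cvgrPdist_lt => e e0.
(* Convergence of [u j] is only known from stage [j.+1] on, so the diagonal index must be at least
   [j.+1] for [g n] to factor through that stage. *)
have [N _ NP] := lP _ e0; exists (maxn N j.+1) => // n /=.
rewrite geq_max => /andP[Nn jn].
have [k kincr] := gfactor j.+1 (n - j.+1)%N; rewrite subnKC// => ->.
by apply: NP; exact: leq_trans Nn (increasing_seq_ge _ kincr).
Qed.

Section SequentialCompactness.
Context (R : realType) (X : normedModType R).

Lemma separable_sequence : separable_space X ->
  exists s : nat -> X, forall x e, 0 < e -> exists n, `|x - s n| < e.
Proof.
move=> [D cD dD].
have /pcard_surjP[s sP] := cD.
exists s => x e e0.
have [|y [xy /sP[n _ sn]]] := dD (ball x e) _ (ball_open _ _).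
  by exists x; exact: ballxx.
by exists n; rewrite sn; move: xy; rewrite -ball_normE.
Qed.

Lemma pointwise_limit_clin (v_ : nat -> dual X) (M : R) (v : X -> R) :
  (forall n, `|v_ n| <= M) -> (forall x, v_ n x @[n --> \oo] --> (v x : R^o)) ->
  exists2 w : dual X, (`|w| <= M) & w =1 v.
Proof.
move=> vM vv.
have lv : linear (v : X -> R^o).
  move=> a x y; apply: (cvg_unique (@norm_hausdorff R R^o) (vv _)).
  rewrite (_ : (fun n => _) = (fun n => a *: v_ n x + v_ n y : R^o)); last first.
    by apply/funext => n; rewrite linearP.
  by apply: cvgD (vv y); apply: cvgZl_tmp; exact: vv.
have vle x : `|v x : R^o| <= M * `|x|.
  apply: cvgr_to_le (cvg_norm (vv x)) _; apply: nearW => n.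
  by rewrite (le_trans (clin_normM _ _))// ler_wpM2r.
have [w wv] := clin_mk lv vle; exists w => //.
apply: clin_norm_le => [|x]; last by rewrite wv.
exact: le_trans (normr_ge0 _) (vM 0%N).
Qed.

(* Uniform boundedness lets the limits at nearby points control the increments
   of [v_ n x]. *)
Lemma cvg_dense_points (v_ : nat -> dual X) (M : R) (x : X) :
  (forall n, `|v_ n| <= M) ->
  (forall e, 0 < e -> exists2 y, `|x - y| < e & cvgn (fun n => v_ n y : R^o)) ->
  cvgn (fun n => v_ n x : R^o).
Proof.
move=> vM xD; have M0 : 0 <= M by exact: le_trans (normr_ge0 _) (vM 0%N).
apply/cauchy_cvgP/cauchy_ballP => e e0.
have e3 : 0 < e / 3 by lra.
(* Dividing by [M + 1] covers the case [M = 0]. *)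
have M1 : 0 < M + 1 by lra.
have [y xy /cauchy_cvgP/cauchy_ballP/(_ _ e3)] := xD _ (divr_gt0 e3 M1).
have vxy n : `|v_ n x - v_ n y| <= e / 3.
  rewrite -linearB (le_trans (clin_normM _ _))//.
  rewrite (@le_trans _ _ ((M + 1) * `|x - y|))//.
    by rewrite ler_wpM2r// (le_trans (vM n))// lerDl.
  by rewrite mulrC -ler_pdivlMr// ltW.
rewrite !near_simpl /=; apply: filterS => -[m n] /=.
rewrite -!ball_normE/= => mn.
have := vxy m; have := vxy n; rewrite distrC => vn vm.
have -> : v_ m x - v_ n x =
    (v_ m x - v_ m y : R) + (v_ m y - v_ n y : R) + (v_ n y - v_ n x : R).
  by ring.
rewrite (le_lt_trans (ler_normD _ _))//.
rewrite (@lt_le_trans _ _ (e / 3 + e / 3 + e / 3))//; last lra.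
rewrite ltr_leD// (le_lt_trans (ler_normD _ _))//.
by rewrite ler_ltD.
Qed.

(** Sequential Banach-Alaoglu: a diagonal subsequence converges on a dense sequence, and the uniform
    bound carries convergence to every point. *)
Lemma weak_star_sequential_compactness (v_ : nat -> dual X) (M : R) :
  separable_space X -> (forall n, `|v_ n| <= M) ->
  exists2 f : nat -> nat, increasing_seq f &
    exists v : dual X, weak_star_cvg (v_ \o f) v.
Proof.
move=> /separable_sequence[s sD] vM.
have [|f fincr fcvg] := @diagonal_subsequence R (fun j n => v_ n (s j))
    (fun j => M * `|s j|).
  by move=> j n; rewrite (le_trans (clin_normM _ _))// ler_wpM2r.
exists f => //.
have vfM n : `|(v_ \o f) n| <= M by exact: vM.
have vcvg x : exists l, (v_ \o f) n x @[n --> \oo] --> (l : R^o).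
  apply/cvg_ex; apply: (cvg_dense_points vfM) => e e0.
  by have [n xsn] := sD x _ e0; exists (s n) => //; exact: fcvg.
have [v vv] := choice vcvg.
have [w _ wv] := pointwise_limit_clin vfM vv.
by exists w; apply/weak_star_cvgP => x; rewrite wv.
Qed.

End SequentialCompactness.

(* The functionals that converge along a subsequence form a closed subspace of
   the dual; by reflexivity it is everything as soon as it separates points. *)
Lemma weak_sequential_compactness (R : realType) (X : normedModType R)
    (x_ : nat -> X) (M : R) :
  reflexive_space X -> separable_space X -> (forall n, `|x_ n| <= M) ->
  exists2 f : nat -> nat, increasing_seq f & exists x, weak_cvg (x_ \o f) x.
Proof.
move=> reflX /separable_sequence[s sD] xM.
(* Norming functionals of a dense sequence form a countable family that separates points. *)
have /choice[w wP] n : exists g : dual X, `|g| <= 1 /\ `|s n| <= `|g (s n)|.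
  by have [g] := norming_functional (s n); exists g.
have [|f fincr fcvg] := @diagonal_subsequence R (fun j n => w j (x_ n)) (fun=> M).
  move=> j n; rewrite (le_trans (clin_normM _ _))// (le_trans _ (xM n))//.
  by rewrite ler_piMl// (wP j).1.
exists f => //.
(* Seen in the bidual, the points are functionals, to which the results on pointwise limits
   apply. *)
have evP n : exists phi : dual (dual X), phi =1 (fun v : dual X => v (x_ (f n))).
  apply: (@clin_mk R (dual X) R^o _ `|x_ (f n)|) => [//|v].
  by rewrite mulrC clin_normM.
have [ev evE] := choice evP.
have evM n : `|ev n| <= M.
  rewrite (le_trans _ (xM (f n)))//; apply: clin_norm_le => // v.
  by rewrite evE mulrC clin_normM.
pose V := [set v : dual X | cvgn (fun n => ev n v : R^o)].
have Vw j : V (w j).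
  by rewrite /V/=; under eq_fun do rewrite evE; exact: fcvg.
have V0 : V !=set0 by exists (w 0%N).
have VL a b v v' : V v -> V v' -> V (a *: v + b *: v').
  move=> /cvg_ex[l vl] /cvg_ex[l' vl']; apply/cvg_ex; exists (a *: l + b *: l').
  rewrite (_ : (fun n => _) = (fun n => a *: ev n v + b *: ev n v' : R^o)).
    by apply: cvgD; apply: cvgZl_tmp.
  by apply/funext => n; rewrite linearD !linearZ.
have cvxV : convex_set V by apply/convex_setP => *; exact: VL.
have clV : closed V.
  move=> v Vv; apply: (cvg_dense_points evM) => e e0.
  have [v' [Vv' vv']] := Vv _ (nbhsx_ballx v _ e0).
  by exists v' => //; move: vv'; rewrite -ball_normE.
(* A functional that separates [v] from the subspace [V] is bounded above on [V], hence zero there.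
   By reflexivity it is evaluation at some [x], which every [w n] annihilates; so [x = 0], and the
   functional is zero. *)
have VT v : V v.
  apply: contrapT => nVv.
  have [phi [e [e0 phiV]]] := strict_separation V0 clV cvxV nVv.
  have phi0 v' : V v' -> phi v' = 0.
    move=> Vv'; apply/eqP; apply: contraT => phiv'0.
    have := phiV _ (VL ((phi v + 1) / phi v') 0 _ _ Vv' Vv').
    rewrite scale0r addr0 linearZ/= [_ *: _]mulfVK//.
    by lra.
  have [x phix] := reflX phi.
  have x0 : x = 0.
    apply/eqP; rewrite -normr_le0; apply/ler_addgt0Pl => e1 e10.
    have [n xsn] := sD x (e1 / 2) ltac:(lra).
    have wx : w n x = 0 by rewrite -phix phi0.
    have sn : `|s n| <= e1 / 2.
      have [wn1 wsn] := wP n; rewrite (le_trans wsn)//.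
      have -> : w n (s n) = w n (s n - x) by rewrite linearB/= wx subr0.
      rewrite (le_trans (clin_normM _ _))// distrC (le_trans _ (ltW xsn))//.
      by rewrite ler_piMl.
    rewrite addr0; have := ler_normD (x - s n) (s n); rewrite subrK.
    by lra.
  have := phiV _ (Vw 0%N); rewrite !phix x0 !linear0.
  by lra.
have /choice[psi psiE] (v : dual X) : exists l, ev n v @[n --> \oo] --> (l : R^o).
  by apply/cvg_ex; exact: VT.
have [phi _ phiE] := pointwise_limit_clin evM psiE.
have [x phix] := reflX phi; exists x; apply/weak_cvgP => v.
rewrite -phix phiE.
by under eq_fun do rewrite -evE; exact: psiE.
Qed.

(** * Ekeland's variational principle *)

Section ProdComplete.
Context (R : realType) (X Y : completeNormedModType R).

HB.instance Definition _ := Pointed.on (X * Y)%type.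

(** Ekeland's principle will be applied to pairs of a point and a step length, whose space must be
    complete. *)
Let prod_complete (F : set_system (X * Y)) : ProperFilter F -> cauchy F -> cvg F.
Proof.
move=> FF /cauchyP Fc.
have /cauchy_cvgP/cvg_ex[x Fx] : cauchy (fst @ F).
  apply: cauchy_exP => e e0; have [z zF] := Fc _ e0; exists z.1.
  by apply: (@filterS _ F _ (ball z e) _ _ zF) => w zw; apply zw.
have /cauchy_cvgP/cvg_ex[y Fy] : cauchy (snd @ F).
  apply: cauchy_exP => e e0; have [z zF] := Fc _ e0; exists z.2.
  by apply: (@filterS _ F _ (ball z e) _ _ zF) => w zw; apply zw.
apply/cvg_ex; exists (x, y) => A [[B C] /= [/Fx FB /Fy FC] BCA].
by apply: (@filterS _ F _ _ _ _ (@filterI _ F _ (fst @^-1` B) (snd @^-1` C)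
  FB FC)) => -[a b]; exact: BCA.
Qed.

HB.instance Definition _ := Uniform_isComplete.Build (X * Y)%type prod_complete.

End ProdComplete.

Section Ekeland.
Context (R : realType) (V : completeNormedModType R).

(** Let [S v] be the points that improve on [v] by at least [al] times their distance to [v]. Each
    [u n.+1] minimizes [f] over [S (u n)] up to [1 / (n + 1)]. The values decrease to a limit, which
    makes [u] Cauchy with limit [v] in every [S (u n)]. A point strictly better than [v] would by
    transitivity also lie in every [S (u n)], and then near-minimality gives [f v <= f w]. *)
Theorem ekeland (E : set V) (f : V -> R) (m al : R) (v0 : V) :
  0 < al -> closed E -> continuous f -> (forall v, E v -> m <= f v) -> E v0 ->
  exists v, [/\ E v, f v + al * `|v - v0| <= f v0 &
    forall w, E w -> f v <= f w + al * `|w - v|].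
Proof.
move=> al0 cE cf mf Ev0.
pose S v := [set w | E w /\ f w + al * `|w - v| <= f v].
have Sself v : E v -> S v v.
  by move=> Ev; split; rewrite // subrr normr0 mulr0 addr0.
have /choice[N NP] (vn : V * nat) : exists w, E vn.1 -> S vn.1 w /\
    forall w', S vn.1 w' -> f w <= f w' + vn.2.+1%:R^-1.
  case: vn => v n /=; have [Ev|nEv] := pselect (E v); last by exists v.
  have infS : has_inf [set f w | w in S v].
    split; first by exists (f v), v => //; exact: Sself.
    by exists m => _ [w [Ew _] <-]; exact: mf.
  have nV0 : 0 < n.+1%:R^-1 :> R by rewrite invr_gt0.
  have [_ [w Sw <-] wlt] := inf_adherent nV0 infS.
  exists w => _; split => // w' Sw'.
  rewrite (le_trans (ltW wlt))// lerD2r; apply: inf_lbound; last by exists w'.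
  by have [] := infS.
pose u := fix u n := if n is k.+1 then N (u k, k) else v0.
have uE n : E (u n) by elim: n => // n ih; have [[]] := NP (u n, n) ih.
have uS n : S (u n) (u n.+1) by have [] := NP (u n, n) (uE n).
have Strans a b c : S a b -> S b c -> S a c.
  move=> [Eb ab] [Ec bc]; split => //.
  have := ler_distD b c a; rewrite -(ler_pM2l al0) mulrDr.
  by lra.
have uSS n k : S (u n) (u (n + k)%N).
  elim: k => [|k ih]; first by rewrite addn0; exact: Sself.
  by rewrite addnS; exact: Strans ih (uS _).
have fu_noninc : {homo f \o u : n k / (n <= k)%N >-> k <= n}.
  move=> n k nk; have [_] := uSS n (k - n)%N; rewrite subnKC//=; apply: le_trans.
  by rewrite lerDl mulr_ge0// ltW.
have /cvg_ex[L fuL] : cvgn (f \o u).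
  apply: nonincreasing_is_cvgn => //.
  by exists m => _ [n _ <-]; exact: mf.
have L_le n : L <= f (u n).
  apply: cvgr_to_le fuL _; exists n => // k nk; exact: fu_noninc.
have /cauchy_cvgP/cvg_ex[v uv] : cauchy (u @ \oo).
  apply: cauchy_exP => e e0; have ale : 0 < al * e by exact: mulr_gt0.
  have [M _ /(_ M (leqnn M)) uM] := iffLR (@cvgrPdist_lt _ _ _ _ _ _ _) fuL _ ale.
  exists (u M), M => // n Mn /=; rewrite -ball_normE /=.
  have [_] := uSS M (n - M)%N; rewrite subnKC// => uMn.
  have uL : f (u M) - L < al * e by rewrite (le_lt_trans (ler_norm _))// distrC.
  have Ln := L_le n.
  rewrite -(ltr_pM2l al0) distrC.
  by lra.
have uSv n : S (u n) v.
  split.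
    by apply: (closed_cvg _ cE _ _ uv); apply: nearW.
  have fuv : f (u k) + al * `|u k - u n| @[k --> \oo] --> f v + al * `|v - u n|.
    apply: cvgD; first exact: cvg_comp uv (cf v).
    by apply: cvgMl_tmp; apply: cvg_norm; apply: cvgB uv (cvg_cst _).
  apply: cvgr_to_le fuv _; exists n => // k nk /=.
  by have [_] := uSS n (k - n)%N; rewrite subnKC.
exists v; split; [by have [] := uSv 0%N|by have [] := uSv 0%N|].
move=> w Ew; rewrite leNgt; apply/negP => wv.
have Svw : S v w by split => //; exact: ltW.
have : f v <= f w.
  have fvu n : f v <= f w + n.+1%:R^-1.
    have [_ /(_ _ (Strans _ _ _ (uSv n) Svw))] := NP (u n, n) (uE n).
    apply: le_trans; have [_] := uSv n.+1; apply: le_trans.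
    by rewrite lerDl mulr_ge0// ltW.
  apply/ler_addgt0Pr => e e0; have [n _ nP] := near_infty_natSinv_lt (PosNum e0).
  by rewrite (le_trans (fvu n))// lerD2l ltW//; exact: (nP n (leqnn n)).
have : 0 <= al * `|w - v| by rewrite mulr_ge0// ltW.
by lra.
Qed.

End Ekeland.

(** * Lagrange multipliers *)

(** Partial minimization preserves joint convexity: near-minimizers for [v] and [w] are combined
    with the same weights. The lower bounds make the infima genuine. *)
Lemma inf_convex_fun (R : realType) (V Z : lmodType R) (S : set Z)
    (Phi : V -> Z -> R) :
  S !=set0 -> (forall v, exists m, forall z, S z -> m <= Phi v z) ->
  (forall v w z z' a b, S z -> S z' -> 0 <= a -> 0 <= b -> a + b = 1 ->
    S (a *: z + b *: z') /\
    Phi (a *: v + b *: w) (a *: z + b *: z') <= a * Phi v z + b * Phi w z') ->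
  convex_fun (fun v => inf [set Phi v z | z in S]).
Proof.
move=> [z0 Sz0] lbPhi cvxPhi v w a b a0 b0 ab1.
have infP x : has_inf [set Phi x z | z in S].
  split; first by exists (Phi x z0), z0.
  by have [m mP] := lbPhi x; exists m => _ [z Sz <-]; exact: mP.
apply/ler_addgt0Pr => e e0.
have [_ [z Sz <-] vz] := inf_adherent e0 (infP v).
have [_ [z' Sz' <-] wz] := inf_adherent e0 (infP w).
have [Szz le_zz] := cvxPhi v w z z' a b Sz Sz' a0 b0 ab1.
apply: (@le_trans _ _ (a * Phi v z + b * Phi w z')).
  apply: le_trans le_zz; apply: inf_lbound.
    by have [] := infP (a *: v + b *: w).
  by exists (a *: z + b *: z').
have -> : e = a * e + b * e by rewrite -mulrDl ab1 mul1r.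
by rewrite addrACA -!mulrDr lerD// ler_wpM2l// ltW.
Qed.

Lemma norm_convex_comb (R : realType) (X : normedModType R) (x y : X) a b :
  0 <= a -> 0 <= b -> `|a *: x + b *: y| <= a * `|x| + b * `|y|.
Proof.
by move=> a0 b0; rewrite (le_trans (ler_normD _ _))// !normrZ !ger0_norm.
Qed.

Section Multipliers.
Context (R : realType) (X Y : normedModType R) (C : set X) (K : set Y).
Context (T : {linear X -> Y}) (x u d : X) (y0 : Y) (n al c : R).
Hypotheses (Ccvx : convex_set C) (Kcvx : convex_set K) (K0 : K !=set0).
Hypotheses (n0 : 0 <= n) (al0 : 0 <= al) (Cx : C x).
Local Notation D := (distance K).
(** Optimality of [(h, sg) = (0, 0)] in a linearized convex problem; the gain [c] per unit of [sg]
    becomes the lower bound for [v d]. *)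
Hypothesis minimality : forall h sg, C (x + h) -> 0 <= sg ->
  `|u| + n * D y0 + c * sg <=
  `|u + (h - sg *: d)| + al * `|h - sg *: d| + n * D (y0 + T h).

Let S : set (X * R^o) := [set z | C (x + z.1) /\ 0 <= z.2].

Let L (v : X * Y) (z : X * R^o) := z.1 - z.2 *: d + v.1.

(* The objective perturbed by v: its infimum over S is convex in v, and a
   linear minorant supplies the multipliers. *)
Let Phi (v : X * Y) (z : X * R^o) : R :=
  `|u + L v z| + al * `|L v z| + n * D (y0 + (T z.1 + v.2)) - c * z.2.

Let q0 := `|u| + n * D y0.

Let L_comb v w z z' a b :
  L (a *: v + b *: w) (a *: z + b *: z') = a *: L v z + b *: L w z'.
Proof.
have -> : L (a *: v + b *: w) (a *: z + b *: z') =
    (a *: z.1 + b *: z'.1) - (a *: (z.2 *: d) + b *: (z'.2 *: d)) +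
    (a *: v.1 + b *: w.1).
  by rewrite /L /= scalerDl !scalerA.
by rewrite /L !scalerDr !scalerN opprD (addrACA (a *: z.1)) [LHS]addrACA.
Qed.

Let Phi_convex v w z z' a b : S z -> S z' -> 0 <= a -> 0 <= b -> a + b = 1 ->
  S (a *: z + b *: z') /\
  Phi (a *: v + b *: w) (a *: z + b *: z') <= a * Phi v z + b * Phi w z'.
Proof.
move=> [Cz z0] [Cz' z'0] a0 b0 ab1; split.
  split => /=; last by rewrite addr_ge0// mulr_ge0.
  have -> : x + (a *: z.1 + b *: z'.1) = a *: (x + z.1) + b *: (x + z'.1).
    by rewrite !scalerDr addrACA -scalerDl ab1 scale1r.
  exact: (iffLR (convex_setP _) Ccvx).
rewrite /Phi L_comb; move: (L v z) (L w z') => l l'.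
have -> : u + (a *: l + b *: l') = a *: (u + l) + b *: (u + l').
  by rewrite !scalerDr addrACA -scalerDl ab1 scale1r.
have := norm_convex_comb (u + l) (u + l') a0 b0.
have := ler_wpM2l al0 (norm_convex_comb l l' a0 b0).
have -> : y0 + (T (a *: z + b *: z').1 + (a *: v + b *: w).2) =
    a *: (y0 + (T z.1 + v.2)) + b *: (y0 + (T z'.1 + w.2)).
  rewrite /= linearD !linearZ/= !scalerDr [RHS]addrACA -scalerDl ab1 scale1r.
  by congr (_ + _); rewrite addrACA.
have := ler_wpM2l n0 (distance_convex K0 Kcvx (y0 + (T z.1 + v.2))
  (y0 + (T z'.1 + w.2)) a0 b0 ab1).
rewrite /= -![_ *: (_ : R^o)]/(_ * _).
by lra.
Qed.

(** Removing the perturbation costs at most the Lipschitz constants of the norm terms and of the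
    distance term; [minimality] handles the rest. At [v = 0] this shows that the value function is
    at least [q0]. *)
Let Phi_ge v z : S z -> q0 - (1 + al) * `|v.1| - n * `|v.2| <= Phi v z.
Proof.
move=> [Cz z0]; have := minimality Cz z0; rewrite /Phi /L /q0.
set l := z.1 - z.2 *: d.
have := ler_normB (u + (l + v.1)) v.1; rewrite addrA addrK.
have := ler_normB (l + v.1) v.1; rewrite addrK => /(ler_wpM2l al0).
have := distance_lip K0 (y0 + T z.1) (y0 + (T z.1 + v.2)).
rewrite addrA opprD addNKr normrN => /(ler_wpM2l n0).
by lra.
Qed.

(** The linear minorant of the value function splits as [A a + B y], and [v = - A], [lambda = B].
    Each conclusion tests the minorant at a suitable perturbation and a point of [S]. *)
Lemma multipliers_exist : exists (v : dual X) (lambda : dual Y),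
  [/\ `|v| <= 1 + al, c <= v d,
      forall y, n * D y0 + lambda (y - y0) <= n * D y &
      forall h, C (x + h) -> v h <= lambda (T h)].
Proof.
pose p v := inf [set Phi v z | z in S] - q0.
have S0 : S (0, 0) by split; rewrite /= ?addr0.
have infP v : has_inf [set Phi v z | z in S].
  split; first by exists (Phi v (0, 0)), (0, 0).
  by exists (q0 - (1 + al) * `|v.1| - n * `|v.2|) => _ [z Sz <-]; exact: Phi_ge.
have cvxp : convex_fun p.
  move=> v w a b a0 b0 ab1; rewrite /p.
  have := @inf_convex_fun _ _ _ S Phi (ex_intro _ _ S0) _ Phi_convex v w a b
    a0 b0 ab1.
  have : q0 = (a + b) * q0 by rewrite ab1 mul1r.
  move=> q0E /(_ _)/le_trans H.
  rewrite lerBlDr H//.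
    by move=> v'; eexists; exact: Phi_ge.
  by lra.
have [|f lf fp] := hahn_banach_convex cvxp.
  rewrite subr_ge0; apply: lb_le_inf; first by have [] := infP 0.
  by move=> _ [z Sz <-]; have := Phi_ge 0 Sz; rewrite !normr0 !mulr0 !subr0.
pose F : {linear (X * Y)%type -> R^o} :=
  HB.pack f (GRing.isLinear.Build R (X * Y)%type R^o *:%R f lf).
have FPhi v z : S z -> F v + q0 <= Phi v z.
  move=> Sz; rewrite -lerBrDr (le_trans (fp v))// lerD2r.
  by apply: inf_lbound; [have [] := infP v|exists z].
have [|a|A AE] := @dual_mk R X (fun a => F (a, 0)) (1 + al).
- move=> k a b; rewrite -linearZ -linearD; congr (F (_, _)).
  by rewrite /= scaler0 addr0.
- have := FPhi (a, 0) _ S0; rewrite /Phi /L /= scale0r subr0 add0r linear0 !addr0.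
  by have := ler_normD u a; rewrite /q0; lra.
have [|y|B BE] := @dual_mk R Y (fun y => F (0, y)) n.
- move=> k a b; rewrite -linearZ -linearD; congr (F (_, _)).
  by rewrite /= scaler0 addr0.
- have := FPhi (0, y) _ S0; rewrite /Phi /L /= scale0r subr0 addr0 linear0 add0r.
  rewrite normr0 addr0.
  have := distance_lip K0 (y0 + y) y0.
  rewrite addrAC subrr add0r => /(ler_wpM2l n0).
  by rewrite /q0; lra.
have FE a y : F (a, y) = A a + B y.
  by rewrite AE BE -linearD; congr (F (_, _)); rewrite /= ?addr0 ?add0r.
(* The perturbation [(sg *: d - h, - T h)] undoes the displacement in the norm and distance terms,
   so that [Phi] reduces to [q0 - c * sg]. *)
have key h sg : C (x + h) -> 0 <= sg -> A (sg *: d - h) - B (T h) + c * sg <= 0.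
  move=> Ch sg0; have := FPhi (sg *: d - h, - T h) (h, sg) (conj Ch sg0).
  rewrite FE linearN /Phi /L /= (_ : h - _ + _ = 0); last first.
    by rewrite addrA subrK subrr.
  rewrite normr0 mulr0 subrr !addr0 /q0.
  by lra.
exists (- A), B; split.
- rewrite normrN; apply: clin_norm_le => [|a]; first by rewrite addr_ge0.
  have Ale b : A b <= (1 + al) * `|b|.
    have := FPhi (b, 0) _ S0; rewrite FE linear0 /Phi /L /= scale0r subr0 add0r.
    by rewrite linear0 !addr0; have := ler_normD u b; rewrite /q0; lra.
  by rewrite ler_norml Ale andbT lerNl -linearN -normrN Ale.
- have := key 0 1; rewrite addr0 scale1r subr0 !linear0 clinNE.
  move=> /(_ Cx ler01).
  by lra.
- move=> y; have := FPhi (0, y - y0) _ S0.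
  rewrite FE linear0 /Phi /L /= scale0r subr0 addr0 linear0 add0r normr0 addr0.
  rewrite add0r [y0 + _]addrC subrK /q0.
  by lra.
- move=> h Ch; have := key h 0 Ch (lexx _); rewrite scale0r sub0r linearN clinNE.
  by lra.
Qed.

End Multipliers.

Lemma frechet_estimate (R : realType) (X Y : normedModType R) (G : X -> Y) x e :
  differentiable G x -> 0 < e ->
  exists2 del, 0 < del &
    forall h, `|h| < del -> `|G (x + h) - G x - 'd G x h| <= e * `|h|.
Proof.
move=> /diff_locally/eqaddoP/[apply] /nbhs_ballP[del /= del0 Gdel].
exists del => // h hdel; have := Gdel h.
rewrite -ball_normE /= sub0r normrN => /(_ hdel).
by rewrite /= /cst !fctE [h + x]addrC opprD addrA.
Qed.

(** * First-order condition at an approximate minimizer *)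

Section FirstOrder.
Context (R : realType) (X Y : normedModType R) (G : X -> Y).
Context (C : set X) (K : set Y) (xbar d x : X) (s t n al b : R).
Local Notation D := (distance K).

(** Minimality is tested at [x + tau h], [s + tau sg], which is admissible for small [tau] as
    [s < t]. Convexity bounds the increments by [tau] times those of the full step, and [tau] is
    divided out. The loss [al * (1 + |d|)] comes from [|h| <= |w| + sg * |d|] in the Ekeland
    term. *)
Lemma first_order_condition :
  convex_set C -> convex_set K -> K !=set0 -> differentiable G x ->
  C x -> 0 <= n -> 0 <= al -> 0 <= s -> s < t ->
  (forall (x' : X) (s' : R), C x' -> 0 <= s' <= t ->
    `|x - xbar - s *: d| + n * D (G x) - b * s <=
    `|x' - xbar - s' *: d| + n * D (G x') - b * s' +
      al * (`|x' - x| + `|s' - s|)) ->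
  forall (h : X) (sg : R), C (x + h) -> 0 <= sg ->
    `|x - xbar - s *: d| + n * D (G x) + (b - al * (1 + `|d|)) * sg <=
    `|x - xbar - s *: d + (h - sg *: d)| + al * `|h - sg *: d| +
      n * D (G x + 'd G x h).
Proof.
move=> Ccvx Kcvx K0 dG Cx n0 al0 s0 st xmin h sg Ch sg0.
set u := x - xbar - s *: d; set w := h - sg *: d.
apply/ler_addgt0Pr => e e0.
(* With relative accuracy [e / (n * |h| + 1)] the linearization error, multiplied by [n], stays
   below [tau * e]. *)
have nh0 : 0 < n * `|h| + 1 by rewrite ltr_wpDl// mulr_ge0.
have [del del0 Gdel] := frechet_estimate dG (divr_gt0 e0 nh0).
have [tau [tau0 tau1 tauh tausg]] : exists tau, [/\ 0 < tau, tau <= 1,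
    tau * `|h| < del & tau * sg <= t - s].
  have h1 : 0 < `|h| + 1 by rewrite ltr_wpDl.
  have sg1 : 0 < sg + 1 by rewrite ltr_wpDl.
  exists (Num.min 1 (Num.min (del / (`|h| + 1)) ((t - s) / (sg + 1)))); split.
  - by rewrite !lt_min ltr01 !divr_gt0// subr_gt0.
  - by rewrite ge_min lexx.
  - apply: (@le_lt_trans _ _ (del / (`|h| + 1) * `|h|)).
      by rewrite ler_wpM2r// !ge_min lexx orbT.
    by rewrite mulrAC ltr_pdivrMr// ltr_pM2l// ltrDl.
  - apply: (@le_trans _ _ ((t - s) / (sg + 1) * sg)).
      by rewrite ler_wpM2r// !ge_min lexx !orbT.
    by rewrite mulrAC ler_pdivrMr// ler_pM2l ?subr_gt0// lerDl.
have tau1' : 0 <= 1 - tau by rewrite subr_ge0.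
have comb (V : lmodType R) (v z : V) :
    v + tau *: z = (1 - tau) *: v + tau *: (v + z).
  by rewrite scalerBl scale1r scalerDr addrA subrK.
have Cxh : C (x + tau *: h).
  by rewrite comb; apply: (iffLR (convex_setP _) Ccvx); rewrite ?subrK// ltW.
have s't : 0 <= s + tau * sg <= t.
  by rewrite addr_ge0 ?mulr_ge0 ?(ltW tau0)//=; lra.
have := xmin _ _ Cxh s't.
have -> : x + tau *: h - xbar - (s + tau * sg) *: d = u + tau *: w.
  rewrite /u /w scalerBr scalerDl scalerA opprD !addrA.
  by congr (_ + _); rewrite [RHS]addrAC; congr (_ + _); rewrite addrAC.
have -> : x + tau *: h - x = tau *: h by rewrite addrAC subrr add0r.
have -> : s + tau * sg - s = tau * sg by rewrite addrAC subrr add0r.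
rewrite normrZ (gtr0_norm tau0) ger0_norm ?mulr_ge0 ?(ltW tau0)//.
have := norm_convex_comb u (u + w) tau1' (ltW tau0); rewrite -comb.
have := Gdel (tau *: h); rewrite normrZ (gtr0_norm tau0) => /(_ tauh).
have := distance_lip K0 (G (x + tau *: h)) (G x + 'd G x (tau *: h)).
have := distance_convex K0 Kcvx (G x) (G x + 'd G x h) tau1' (ltW tau0).
rewrite subrK -comb linearZ/= => /(_ erefl) D1 D2 D3 N1.
move=> M1.
have D4 : n * D (G (x + tau *: h)) <=
    n * ((1 - tau) * D (G x) + tau * D (G x + 'd G x h)) + tau * e.
  have : n * (e / (n * `|h| + 1) * (tau * `|h|)) <= tau * e.
    rewrite [leLHS](_ : _ = tau * e * (n * `|h| / (n * `|h| + 1))); last first.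
      by field; rewrite gt_eqF.
    apply: ler_piMr; first by rewrite mulr_ge0 ?ltW.
    by rewrite ler_pdivrMr// mul1r lerDl.
  move: D2; rewrite opprD addrA => /le_trans/(_ (lerD D1 D3))/(ler_wpM2l n0).
  by lra.
have hw : al * (tau * `|h|) <= al * tau * (`|w| + sg * `|d|).
  rewrite -mulrA !ler_wpM2l ?(ltW tau0)//.
  have := ler_normD w (sg *: d); rewrite normrZ (ger0_norm sg0).
  by rewrite /w subrK.
rewrite -(ler_pM2l tau0).
by lra.
Qed.

End FirstOrder.

(** * Tangent cones *)

Section TangentCone.
Context (R : realType) (X Y : normedModType R).

(** If each [e = 1 / (k + 1)] failed, the violating pairs would have quotients converging to [d] and
    steps converging to 0, making [d] tangent. *)
Lemma not_tangent (Q : set X) (x d : X) : ~ tangent_cone Q x d ->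
  exists2 e : R, 0 < e &
    forall t y, 0 < t -> t < e -> Q y -> e * t <= `|y - x - t *: d|.
Proof.
move=> nTd; apply: contrapT => noe; apply: nTd.
have /choice[yt ytP] (k : nat) : exists yt : X * R, [/\ Q yt.1, 0 < yt.2,
    yt.2 < k.+1%:R^-1 & `|yt.1 - x - yt.2 *: d| < k.+1%:R^-1 * yt.2].
  apply: contrapT => nyt; apply: noe; exists k.+1%:R^-1.
    by rewrite invr_gt0.
  move=> t y t0 tk Qy; rewrite leNgt; apply/negP => lt_y.
  by apply: nyt; exists (y, t).
have inv0 e : 0 < e -> \forall k \near \oo, k.+1%:R^-1 < e :> R.
  by move=> e0; exact: near_infty_natSinv_lt (PosNum e0).
have t0 : (yt k).2 @[k --> \oo] --> (0 : R).
  apply/cvgrPdist_lt => e /inv0[N _ NP]; exists N => // k /NP; apply: le_lt_trans.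
  by have [_ t0 /ltW tk _] := ytP k; rewrite sub0r normrN gtr0_norm.
have quot : ((yt k).2)^-1 *: ((yt k).1 - x) @[k --> \oo] --> d.
  apply/cvgrPdist_lt => e /inv0[N _ NP]; exists N => // k /NP; apply: le_lt_trans.
  have [_ tk0 _ /ltW yk] := ytP k; rewrite distrC.
  have -> : ((yt k).2)^-1 *: ((yt k).1 - x) - d =
      ((yt k).2)^-1 *: ((yt k).1 - x - (yt k).2 *: d).
    by rewrite [RHS]scalerBr scalerA mulVf ?gt_eqF// scale1r.
  by rewrite normrZ gtr0_norm ?invr_gt0// ler_pdivrMl// mulrC.
exists (fun k => (yt k).1), (fun k => (yt k).2); split => //.
- by move=> k; have [] := ytP k.
- by move=> k; have [] := ytP k.
have : (yt k).2 *: (((yt k).2)^-1 *: ((yt k).1 - x)) + x @[k --> \oo] -->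
    0 *: d + x.
  by apply: cvgD (cvg_cst _); exact: cvgZ.
rewrite scale0r add0r; apply: cvg_trans; apply: near_eq_cvg; apply: nearW => k.
by have [_ tk0 _ _] := ytP k; rewrite scalerA mulfV ?gt_eqF// scale1r subrK.
Qed.

(** The image sequence keeps the same steps [t k]. Its quotients differ from the linearized ones by
    a term that vanishes, as [|y k - x| / t k] is eventually at most [|d| + 1]. *)
Lemma tangent_cone_diff (G : X -> Y) (Q : set X) (K : set Y) (x d : X) :
  differentiable G x -> (forall y, Q y -> K (G y)) -> tangent_cone Q x d ->
  tangent_cone K (G x) ('d G x d).
Proof.
move=> dG QK [y [t [Qy t0 tcvg ycvg qcvg]]].
exists (G \o y), t; split => //; first by move=> k; exact: QK.
  exact: cvg_comp ycvg (differentiable_continuous dG).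
have Tq : 'd G x ((t k)^-1 *: (y k - x)) @[k --> \oo] --> 'd G x d.
  have dGc : continuous ('d G x) by exact: diff_continuous.
  exact: cvg_comp qcvg (dGc d).
apply: cvg_sub0 Tq; apply/cvgrPdist_le => e e0.
have d1 : 0 < `|d| + 1 by rewrite ltr_wpDl.
have [del del0 Gdel] := frechet_estimate dG (divr_gt0 e0 d1).
near=> k; rewrite sub0r normrN !fctE.
rewrite linearZ/= -scalerBr normrZ gtr0_norm ?invr_gt0//.
have yk : `|y k - x| < del by rewrite distrC; near: k; exact: cvgr_dist_lt.
have := Gdel _ yk; rewrite [x + _]addrC subrK => Gk.
have qk : `|(t k)^-1 *: (y k - x)| <= `|d| + 1.
  by near: k; apply: (cvgr_norm_le _ qcvg); rewrite ltrDl.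
move: qk; rewrite normrZ gtr0_norm ?invr_gt0// => qk.
rewrite -[leRHS](divfK (lt0r_neq0 d1)).
apply: (@le_trans _ _ ((t k)^-1 * (e / (`|d| + 1) * `|y k - x|))).
  by rewrite ler_wpM2l// invr_ge0 ltW.
by rewrite mulrCA ler_wpM2l// divr_ge0 ?ltW.
Unshelve. all: by end_near. Qed.

Lemma polar_tangent_cone (Q : set X) (x d : X) (v : dual X) :
  (forall y, Q y -> v (y - x) <= 0) -> tangent_cone Q x d -> v d <= 0.
Proof.
move=> vQ [y [t [Qy t0 _ _ qcvg]]].
have : v ((t k)^-1 *: (y k - x)) @[k --> \oo] --> (v d : R^o).
  have vc : continuous v by exact: clin_continuous.
  exact: cvg_comp qcvg (vc d).
move=> /cvgr_to_le; apply; apply: nearW => k.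
by rewrite linearZ/= pmulr_rle0 ?invr_gt0// vQ.
Qed.

End TangentCone.

(** * The constraint system *)

Section NormBall.
Context (R : realType) (X : normedModType R) (z : X) (r : R).

Lemma closed_norm_ball : closed [set x | `|x - z| <= r].
Proof.
have fc : continuous (fun x : X => `|x - z| : R^o).
  by move=> x; apply: cvg_norm; apply: cvgB; [exact: cvg_id|exact: cvg_cst].
apply: (@closed_comp _ _ _ [set y : R^o | y <= r]) => [x _|]; first exact: fc.
exact: closed_le.
Qed.

Lemma convex_norm_ball : convex_set [set x : X | `|x - z| <= r].
Proof.
apply/convex_setP => x y a b /= xz yz a0 b0 ab1.
have -> : a *: x + b *: y - z = a *: (x - z) + b *: (y - z).
  by rewrite !scalerBr addrACA -opprD -scalerDl ab1 scale1r.
rewrite (le_trans (norm_convex_comb _ _ a0 b0))//.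
have -> : r = a * r + b * r by rewrite -mulrDl ab1 mul1r.
by rewrite lerD// ler_wpM2l.
Qed.

End NormBall.

Section ConstraintSystem.
Context (R : realType) (X Y : completeNormedModType R).
Context (G : X -> Y) (C : set X) (K : set Y).
Hypotheses (dG : forall x, differentiable G x).
Hypotheses (Ccl : closed C) (Ccvx : convex_set C).
Hypotheses (K0 : K !=set0) (Kcvx : convex_set K).
Local Notation D := (distance K).

(** Violators for all [n] stay within [r] of [z], and the distances of their images to [K] tend to
    0. A weak limit is feasible and, closed balls being weakly closed, still within [r < r'] of
    [z]. *)
Lemma penalty_bound (z : X) (r r' : R) :
  reflexive_space X -> separable_space X ->
  (forall (x_ : nat -> X) (x : X),
      (forall k, C (x_ k)) -> C x -> weak_cvg x_ x ->
      distance K (G (x_ k)) @[k --> \oo] --> (0 : R) -> K (G x)) ->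
  r < r' -> (forall y, feasible G C K y -> r' <= `|y - z|) ->
  exists n : nat, forall x, C x -> r <= `|x - z| + n%:R * D (G x).
Proof.
move=> Xrefl Xsep Gimp rr' zF; apply: contrapT => /forallNP nn.
have /choice[x_ xP] n : exists x, C x /\ `|x - z| + n%:R * D (G x) < r.
  have /existsNP[x /not_implyP[Cx /negP]] := nn n; rewrite -ltNge => xr.
  by exists x.
have D0 y : 0 <= D y by exact: distance_ge0.
have xr n : `|x_ n - z| <= r.
  by have [_ /ltW] := xP n; apply: le_trans; rewrite lerDl mulr_ge0.
have r0 : 0 <= r by rewrite (le_trans _ (xr 0%N)).
have xM n : `|x_ n| <= r + `|z|.
  have := ler_normD (x_ n - z) z; rewrite subrK => /le_trans; apply.
  by rewrite lerD2r.
have [f fincr [x xx]] := weak_sequential_compactness Xrefl Xsep xM.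
have Cx : C x by apply: closed_convex_weak_limit xx => // n; exact: (xP _).1.
have xr' n : [set x | `|x - z| <= r] ((x_ \o f) n) by exact: xr.
have xz : `|x - z| <= r.
  exact: closed_convex_weak_limit (@closed_norm_ball _ _ z r)
    (@convex_norm_ball _ _ z r) xr' xx.
have Kx : K (G x).
  apply: (Gimp (x_ \o f)) => // [k|]; first exact: (xP _).1.
  have r1 : 0 < r + 1 by lra.
  apply/cvgrPdist_lt => e e0.
  have [N _ NP] := near_infty_natSinv_lt (PosNum (divr_gt0 e0 r1)).
  (* Only positive indices [n.+1] are considered, so that the penalty weight [f n.+1 >= n.+1] is
     nonzero. *)
  exists N.+1 => // -[//|n] Nn; rewrite sub0r normrN ger0_norm//=.
  have fn : n.+1%:R <= (f n.+1)%:R :> R.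
    by rewrite ler_nat; exact: increasing_seq_ge.
  have := NP n Nn; rewrite /= ltr_pdivlMr// mulrC ltr_pdivrMr// => re.
  have nD : n.+1%:R * D (G (x_ (f n.+1))) <= r.
    apply: (@le_trans _ _ ((f n.+1)%:R * D (G (x_ (f n.+1))))).
      by rewrite ler_wpM2r.
    by have [_ /ltW] := xP (f n.+1); apply: le_trans; rewrite lerDr.
  rewrite -(ltr_pM2l (ltr0Sn R n)).
  by lra.
have := zF x (conj Cx Kx).
by lra.
Qed.

(** The normal vector is the remainder of [v] after subtracting the adjoint term; the last
    hypothesis says that it is normal to [C]. *)
Lemma Mset_intro x (v : dual X) (lambda : dual Y) :
  C x -> (forall y, K y -> lambda (y - G x) <= 0) ->
  (forall h, C (x + h) -> v h <= lambda ('d G x h)) -> Mset G C K x 0 v.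
Proof.
move=> Cx lK vC.
have Tin : ('d G x : X -> Y) \in @clinear R X Y.
  by apply/clinearP; split; [exact: linearP|exact: diff_continuous].
pose T := Clin Tin.
have [lT lTE] : exists lT : dual X, lT =1 lambda \o T.
  apply: (@clin_mk R X R^o _ (`|lambda| * `|T|)) => [a h k /=|h /=].
    by rewrite !linearP.
  rewrite (le_trans (clin_normM _ _))// -mulrA ler_wpM2l//.
  exact: (clin_normM T h).
exists lambda, (v - lT); split => // [|h]; last first.
  by rewrite clinBE lTE/= addrC subrK.
split => // z Cz; rewrite clinBE lTE/= subr_le0.
by apply: vC; rewrite addrC subrK.
Qed.

Lemma nontangent_multiplier (xbar d : X) (e t : R) :
  reflexive_space X -> separable_space X ->
  (forall (x_ : nat -> X) (x : X),
      (forall k, C (x_ k)) -> C x -> weak_cvg x_ x ->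
      distance K (G (x_ k)) @[k --> \oo] --> (0 : R) -> K (G x)) ->
  feasible G C K xbar -> 0 < e -> 0 < t ->
  (forall y, feasible G C K y -> e * t <= `|y - xbar - t *: d|) ->
  exists (x : X) (v : dual X), [/\ `|x - xbar| <= t * (`|d| + e),
    Mset G C K x 0 v, `|v| <= 2 & e / 4 <= v d].
Proof.
move=> Xrefl Xsep Gimp [Cxbar Kxbar] e0 t0 tF.
(* Any factor strictly between 1/2 and 1 would do: below 1 for the penalty bound, above 1/2 to beat
   the reward [e / 2] on the face [s = t]. *)
have [n nP] : exists n : nat, forall x, C x ->
    3 / 4 * e * t <= `|x - (xbar + t *: d)| + n%:R * D (G x).
  apply: (penalty_bound Xrefl Xsep Gimp _ (r' := e * t)).
    by have : 0 < e * t by [exact: mulr_gt0]; lra.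
  by move=> y /tF; rewrite opprD addrA.
have n0 : 0 <= n%:R :> R by [].
have D0 y : 0 <= D y by exact: distance_ge0.
pose Psi (z : X * R^o) : R :=
  `|z.1 - xbar - z.2 *: d| + n%:R * D (G z.1) - e / 2 * z.2.
pose E : set (X * R^o) := [set z | C z.1 /\ 0 <= z.2 <= t].
have fstc : continuous (fst : X * R^o -> X) by move=> z; exact: cvg_fst.
have sndc : continuous (snd : X * R^o -> R^o) by move=> z; exact: cvg_snd.
have Ecl : closed E.
  have -> : E = (fst @^-1` C) `&` (snd @^-1` (`[0, t]%classic : set R^o)).
    by apply/seteqP; split => z; rewrite /E/= in_itv.
  apply: closedI; first by apply: closed_comp => [z _|//]; exact: fstc.
  by apply: closed_comp => [z _|]; [exact: sndc|exact: interval_closed].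
have Psic : continuous Psi.
  move=> z; apply: cvgB; last first.
    by apply: cvgMl_tmp; exact: sndc.
  apply: cvgD.
    apply: cvg_norm; apply: cvgB.
      by apply: cvgB; [exact: fstc|exact: cvg_cst].
    by apply: cvgZr_tmp; exact: sndc.
  apply: cvgMl_tmp.
  have Gc : G \o fst @ z --> G z.1.
    by apply: cvg_comp (fstc z) _; exact: differentiable_continuous.
  exact: cvg_comp Gc (@distance_continuous _ _ _ K0 (G z.1)).
(* [al <= 1] yields the norm bound [1 + al <= 2], and [al * (1 + |d|) <= e / 4] leaves [e / 4] of
   the slope [e / 2]. *)
pose al := Num.min 1 (e / 4 / (1 + `|d|)).
have d1 : 0 < 1 + `|d| by rewrite ltr_pwDl.
have al0 : 0 < al by rewrite /al lt_min ltr01 divr_gt0//; lra.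
have al1 : al <= 1 by rewrite ge_min lexx.
have ald : al * (1 + `|d|) <= e / 4.
  by rewrite -ler_pdivlMr// ge_min lexx orbT.
have Psi0 : Psi (xbar, 0) = 0.
  by rewrite /Psi /= subrr scale0r subr0 normr0 distance_in// !mulr0 addr0 subr0.
have PsiE z : E z -> - (e / 2 * t) <= Psi z.
  move=> [Cz /andP[z0 zt]]; rewrite /Psi.
  have : e / 2 * z.2 <= e / 2 * t by rewrite ler_wpM2l//; lra.
  have : 0 <= n%:R * D (G z.1) by exact: mulr_ge0.
  have := normr_ge0 (z.1 - xbar - z.2 *: d).
  by lra.
have E0 : E (xbar, 0) by split; rewrite //= lexx ltW.
have [[x s] [[/= Cx /andP[s0 st]] xs_le xs_min]] := ekeland al0 Ecl Psic PsiE E0.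
have Psixs : Psi (x, s) <= 0.
  by rewrite -Psi0 (le_trans _ xs_le)// lerDl mulr_ge0// ltW.
(* On the face [s = t] the objective is at least [e * t / 4 > 0], while the Ekeland point has value
   at most [Psi (xbar, 0) = 0]. *)
have s_lt : s < t.
  rewrite lt_neqAle st andbT; apply/eqP => s_eq; move: Psixs.
  rewrite s_eq /Psi /= => Psixt.
  have := nP x Cx; rewrite opprD addrA.
  have : 0 < e * t by exact: mulr_gt0.
  by lra.
have xclose : `|x - xbar| <= t * (`|d| + e).
  have := ler_normD (x - xbar - s *: d) (s *: d).
  rewrite subrK normrZ (ger0_norm s0).
  have : s * (`|d| + e) <= t * (`|d| + e) by rewrite ler_wpM2r// addr_ge0// ltW.
  have : 0 <= n%:R * D (G x) by exact: mulr_ge0.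
  have : 0 <= e * s by rewrite mulr_ge0// ltW.
  move: Psixs; rewrite /Psi /=.
  by lra.
have [|v [lambda [vle vd lamK vC]]] := @multipliers_exist _ _ _ C K ('d G x) x
    (x - xbar - s *: d) d (G x) n%:R al (e / 2 - al * (1 + `|d|))
    Ccvx Kcvx K0 n0 (ltW al0) Cx.
  apply: (@first_order_condition _ _ _ G C K xbar d x s t n%:R al (e / 2)) => //.
    exact: ltW.
  move=> x' s' Cx' s't; have := xs_min (x', s') (conj Cx' s't).
  rewrite /Psi /= => /le_trans; apply; rewrite lerD2l ler_wpM2l ?(ltW al0)//.
  (* The product carries the maximum norm, which the sum in the first-order condition dominates. *)
  by rewrite prod_normE/= ge_max lerDl lerDr !normr_ge0.
exists x, v; split => //; [|lra|lra].
(* On [K] the distance vanishes, so the subgradient inequality gives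
   [lambda (y - G x) <= - n * D (G x) <= 0], even where [G x] is outside [K]. *)
apply: Mset_intro vC => // y Ky.
have := lamK y; rewrite (distance_in K0 Ky) mulr0.
have : 0 <= n%:R * D (G x) by exact: mulr_ge0.
by lra.
Qed.

End ConstraintSystem.

(** * Polarity, convexity and closedness of the multiplier set *)

Lemma Mset_polar_linearization (R : realType) (X Y : normedModType R)
    (G : X -> Y) (C : set X) (K : set Y) (xbar d : X) (v : dual X) :
  Mset G C K xbar 0 v -> linearization_cone G C K xbar d -> v d <= 0.
Proof.
move=> [lambda [mu [[Cx muC] lamK ->]]] [TCd TKd].
have := polar_tangent_cone muC TCd; have := polar_tangent_cone lamK TKd.
by lra.
Qed.

Lemma Mset_convex (R : realType) (X Y : normedModType R) (G : X -> Y)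
    (C : set X) (K : set Y) (x : X) : convex_set (Mset G C K x 0).
Proof.
apply/convex_setP => v w a b [l [m [[Cx mC] lK vE]]].
move=> [l' [m' [[_ mC'] lK' wE]]] a0 b0 _.
have sgn (p q : R) : p <= 0 -> q <= 0 -> a * p + b * q <= 0.
  by move=> p0 q0; rewrite -oppr_ge0 opprD -!mulrN addr_ge0// mulr_ge0// oppr_ge0.
exists (a *: l + b *: l'), (a *: m + b *: m'); split.
- by split => // z Cz; rewrite clinDE !clinZE; exact: sgn (mC z Cz) (mC' z Cz).
- by move=> y Ky; rewrite clinDE !clinZE; exact: sgn (lK y Ky) (lK' y Ky).
- move=> h; rewrite !clinDE !clinZE vE wE !scalerDr.
  exact: addrACA.
Qed.

(** By reflexivity a separating functional on the dual is evaluation at a point of X, hence weak*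
    continuous, and its gap gives a weak* neighbourhood that misses [M]. *)
Lemma reflexive_weak_star_closed (R : realType) (X : normedModType R)
    (M : set (dual X)) :
  reflexive_space X -> M !=set0 -> convex_set M -> closed M -> weak_star_closed M.
Proof.
move=> Xrefl M0 Mcvx Mcl v Mv; apply: contrapT => nMv.
have [phi [e [e0 phiM]]] := strict_separation M0 Mcl Mcvx nMv.
have [x phix] := Xrefl phi.
have /Mv[w [Mw]] : nbhs (v : weak_star_topology X)
    [set w : weak_star_topology X | `|(v : dual X) x - (w : dual X) x : R^o| < e].
  have /cvgrPdist_lt := @weak_star_eval_continuous R X x v.
  exact.
have := phiM w Mw; rewrite !phix /= ltr_norml.
by lra.
Qed.

Lemma increasing_seq_cvgny (f : nat -> nat) : increasing_seq f -> f @ \oo --> \oo.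
Proof.
move=> fincr A [N _ NA]; exists N => // n Nn; apply: NA.
exact: leq_trans Nn (increasing_seq_ge n fincr).
Qed.

Lemma norm_weak_star_cvg (R : realType) (X : normedModType R)
    (v_ : nat -> dual X) (v : dual X) : v_ @ \oo --> v -> weak_star_cvg v_ v.
Proof.
move=> /cvgrPdist_le vv; apply/weak_star_cvgP => x; apply/cvgrPdist_le => e e0.
have x1 : 0 < `|x| + 1 by rewrite ltr_wpDl.
have [N _ NP] := vv _ (divr_gt0 e0 x1); exists N => // n /NP vn.
rewrite -clinBE (le_trans (clin_normM _ _))// (le_trans (ler_wpM2r _ vn))//.
by rewrite mulrAC ler_pdivrMr// ler_pM2l// lerDl.
Qed.

Lemma sw_AKKT_regular_closed (R : realType) (X Y : normedModType R)
    (G : X -> Y) (C : set X) (K : set Y) (xbar : X) :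
  sw_AKKT_regular G C K xbar -> closed (Mset G C K xbar 0).
Proof.
move=> [_ reg] v Mv; apply: reg.
have /choice[v_ vP] n : exists w, Mset G C K xbar 0 w /\ `|v - w| < n.+1%:R^-1.
  have n0 : 0 < n.+1%:R^-1 :> R by rewrite invr_gt0.
  have [w [Mw vw]] := Mv _ (nbhsx_ballx v _ n0).
  by exists w; split => //; move: vw; rewrite -ball_normE.
exists (fun=> xbar), (fun=> 0), v_; split => //; try exact: cvg_cst.
  apply: norm_weak_star_cvg; apply/cvgrPdist_lt => e e0.
  have [N _ NP] := near_infty_natSinv_lt (PosNum e0); exists N => // n /NP.
  exact: lt_trans (vP n).2.
by move=> k; exact: (vP k).1.
Qed.

Theorem theorem5p9 (R : realType) (X Y : completeNormedModType R)
    (G : X -> Y) (C : set X) (K : set Y) (xbar : X)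
    (hG : continuously_differentiable G)
    (hC0 : C !=set0) (hCcl : closed C) (hCcv : convex_set C)
    (hK0 : K !=set0) (hKcl : closed K) (hKcv : convex_set K)
    (hXrefl : reflexive_space X) (hXsep : separable_space X)
    (hfeas : feasible G C K xbar)
    (hreg : sw_AKKT_regular G C K xbar)
    (himp : forall (x_ : nat -> X) (x : X),
      (forall k, C (x_ k)) -> C x -> weak_cvg x_ x ->
      distance K (G (x_ k)) @[k --> \oo] --> (0 : R) -> K (G x)) :
  tangent_cone (feasible G C K) xbar = linearization_cone G C K xbar /\
  weak_star_closed (Mset G C K xbar 0).

Proof.
have dG x : differentiable G x by have [DG dDG _] := hG; have [] := dDG x.
have [Cxbar Kxbar] := hfeas.
split; last first.
  apply: reflexive_weak_star_closed => //; last exact: sw_AKKT_regular_closed.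
    (* Nonemptiness: the zero functional arises from the zero multiplier. *)
    by exists 0; apply: (@Mset_intro _ _ _ G C K dG xbar 0 0) => //.
  exact: Mset_convex.
apply/seteqP; split=> d.
  move=> Td; split; last by apply: tangent_cone_diff Td => // y [].
  have [y [t [Fy t0 tcvg ycvg qcvg]]] := Td.
  by exists y, t; split => // k; have [] := Fy k.
move=> Ld; apply: contrapT => /not_tangent[e e0 eF].
(* Starting the denominators at 2 keeps every step strictly below [e]. *)
pose t k : R := e / k.+2%:R.
have t0 k : 0 < t k by rewrite divr_gt0.
have te k : t k < e by rewrite ltr_pdivrMr// ltr_pMr// ltr1n.
have /choice[xv xvP] k : exists xv : X * dual X,
    [/\ `|xv.1 - xbar| <= t k * (`|d| + e), Mset G C K xv.1 0 xv.2,
      `|xv.2| <= 2 & e / 4 <= xv.2 d].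
  have [|x [v xvP]] := nontangent_multiplier dG hCcl hCcv hK0 hKcv
    hXrefl hXsep himp hfeas e0 (t0 k) (d := d); last by exists (x, v).
  by move=> y; exact: eF.
pose x_ k := (xv k).1; pose v_ k := (xv k).2.
have v2 k : `|v_ k| <= 2 by have [] := xvP k.
have [f fincr [v vv]] := weak_star_sequential_compactness hXsep v2.
have tcvg : t k @[k --> \oo] --> (0 : R).
  apply/cvgrPdist_lt => r r0.
  have [N _ NP] := near_infty_natSinv_lt (PosNum (divr_gt0 r0 e0)).
  exists N => // k Nk; rewrite sub0r normrN gtr0_norm// /t -ltr_pdivlMl// mulrC.
  exact: (NP k.+1 (leqW Nk)).
have xcvg : x_ @ \oo --> xbar.
  apply/subr_cvg0/norm_cvg0P.
  apply: (@squeeze_cvgr _ _ _ _ (fun=> 0) (fun k => t k * (`|d| + e))).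
  - by apply: nearW => k; rewrite normr_ge0; have [] := xvP k.
  - exact: cvg_cst.
  - by rewrite -[X in _ --> X](mul0r (`|d| + e)); exact: cvgMr_tmp.
have Mv : Mset G C K xbar 0 v.
  apply: hreg.2; exists (x_ \o f), (fun=> 0), (v_ \o f); split => //.
  - exact: cvg_comp (increasing_seq_cvgny fincr) xcvg.
  - exact: cvg_cst.
  - by move=> k; have [] := xvP (f k).
have := Mset_polar_linearization Mv Ld.
(* The lower bound survives the weak* limit and contradicts [v d <= 0]. *)
have : e / 4 <= v d.
  have /weak_star_cvgP/(_ d) vd := vv.
  by apply: cvgr_to_ge vd _; apply: nearW => k; have [] := xvP (f k).
by lra.
Qed.
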